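(* For a general digraph $G=(V,A)$ with $m=|A|$ and each neighborhood $\Phi(X,k)\in\{\Phi^{\mathrm{incl}}(X,k),\Phi^{\mathrm{excl}}(X,k),\Phi^{\mathrm{sym}}(X,k)\}$, the problem \textsc{Rec Rob SP} under $\mathcal{U}(\Gamma^c)$ admits a compact mixed integer programming formulation, i.e. a MIP whose number of variables and constraints is polynomial in $|V|$ and $m$ and whose optimal value equals the optimal value of \textsc{Rec Rob SP}, with an optimal first-stage path readable from an optimal MIP solution.
   Context: Given a digraph $G=(V,A)$ with distinguished nodes $s,t$, $\Phi$ is the set of simple $s$-$t$ paths, each identified with its arc set. For $X\in\Phi$, integer $k\ge0$: $\Phi^{\mathrm{incl}}(X,k)=\{Y\in\Phi:|Y\setminus X|\le k\}$, $\Phi^{\mathrm{excl}}(X,k)=\{Y\in\Phi:|X\setminus Y|\le k\}$, $\Phi^{\mathrm{sym}}(X,k)=\{Y\in\Phi:|(Y\setminus X)\cup(X\setminus Y)|\le k\}$. Given first-stage costs $C_e\ge0$, nominal costs $\hat c_e\ge0$, deviations $\Delta_e\ge0$ and budget $\Gamma^c\ge0$, the continuous budgeted uncertainty set is $\mathcal{U}(\Gamma^c)=\{(c_e^S)_{e\in A}: c_e^S\in[\hat c_e,\hat c_e+\Delta_e],\ \sum_{e\in A}(c^S_e-\hat c_e)\le\Gamma^c\}$. \textsc{Rec Rob SP} under a scenario set $\mathbb{U}$ is $\min_{X\in\Phi}\big(\sum_{e\in X}C_e+\max_{S\in\mathbb{U}}\min_{Y\in\Phi(X,k)}\sum_{e\in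 Y}c^S_e\big)$. *)

(* Defs.v *)
From HB Require Import structures.
From mathcomp Require Import all_boot all_order all_algebra.
From mathcomp Require Import boolp classical_sets reals.
Set Implicit Arguments. Unset Strict Implicit. Unset Printing Implicit Defensive.
Import Order.TTheory GRing.Theory Num.Theory.
Local Open Scope ring_scope.

Section RRSP.
Variables (R : realType) (V Arc : finType) (src dst : Arc -> V) (s t : V).

Fixpoint walk_to_t (u : V) (p : seq Arc) : bool :=
  match p with
  | [::] => u == t
  | e :: p' => (src e == u) && walk_to_t (dst e) p'
  end.

Definition is_stpath (Y : {set Arc}) : Prop :=
  exists p : seq Arc,
    [/\ walk_to_t s p, uniq (s :: map dst p) & Y = [set e in p]].

Inductive nbhd := Incl | Excl | Sym.

Definition in_nbhd (nb : nbhd) (X : {set Arc}) (k : nat) (Y : {set Arc}) : Prop :=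
  is_stpath Y /\
  match nb with
  | Incl => (#|Y :\: X| <= k)%N
  | Excl => (#|X :\: Y| <= k)%N
  | Sym  => (#|(Y :\: X) :|: (X :\: Y)| <= k)%N
  end.

Definition cost (c : Arc -> R) (Y : {set Arc}) : R := \sum_(e in Y) c e.

Definition Ucal (ch D : Arc -> R) (G : R) : set (Arc -> R) :=
  [set c | (forall e, ch e <= c e <= ch e + D e) /\ \sum_e (c e - ch e) <= G].

(* second stage: min over Y in Phi(X,k) of c(Y); X itself belongs to Phi(X,k)
   whenever X is an s-t path, so cost c X is a correct initial value *)
Definition recov (nb : nbhd) (k : nat) (X : {set Arc}) (c : Arc -> R) : R :=
  \big[Order.min/cost c X]_(Y : {set Arc} | `[< in_nbhd nb X k Y >]) cost c Y.

Definition rrsp_obj nb k (C ch D : Arc -> R) (G : R) (X : {set Arc}) : R :=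
  cost C X + sup [set recov nb k X c | c in Ucal ch D G].

Definition rrsp_optimal nb k C ch D G (X : {set Arc}) : Prop :=
  is_stpath X /\
  forall Y, is_stpath Y -> rrsp_obj nb k C ch D G X <= rrsp_obj nb k C ch D G Y.

End RRSP.

Section MIP.
Local Unset Implicit Arguments.
Variables (R : realType) (Arc : finType).

Record affd := Affd {
  a0 : R; aC : Arc -> R; aH : Arc -> R; aD : Arc -> R; aG : R }.

Definition eval_aff (a : affd) (C ch D : Arc -> R) (G : R) : R :=
  a0 a + \sum_e (aC a e * C e + aH a e * ch e + aD a e * D e) + aG a * G.

Record MIP := Mip {
  nvars : nat;
  nconstr : nat;
  intv : 'I_nvars -> bool;
  Amat : 'I_nconstr -> 'I_nvars -> affd;
  bvec : 'I_nconstr -> affd;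
  obj : 'I_nvars -> affd }.


Definition mip_feasible (M : MIP) (C ch D : Arc -> R) (G : R) (z : 'I_(nvars M) -> R) : Prop :=
  (forall j, @intv M j -> exists m : int, z j = m%:~R) /\
  (forall i, \sum_j eval_aff (@Amat M i j) C ch D G * z j
             <= eval_aff (@bvec M i) C ch D G).

Definition mip_objval (M : MIP) (C ch D : Arc -> R) (G : R) (z : 'I_(nvars M) -> R) : R :=
  \sum_j eval_aff (@obj M j) C ch D G * z j.

Definition mip_optsol (M : MIP) (C ch D : Arc -> R) (G : R) (z : 'I_(nvars M) -> R) : Prop :=
  mip_feasible M C ch D G z /\
  forall z', mip_feasible M C ch D G z' ->
    mip_objval M C ch D G z <= mip_objval M C ch D G z'.

(* first-stage path read off the designated variables x_e = z (idx e) *)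
Definition decode (M : MIP) (idx : Arc -> 'I_(nvars M)) (z : 'I_(nvars M) -> R)
  : {set Arc} := [set e | z (idx e) == 1].

End MIP.

Arguments nvars {R Arc}.
Arguments nconstr {R Arc}.
Arguments intv {R Arc} m _.

Arguments nconstr {R Arc}.
Arguments eval_aff {R Arc}.
Arguments mip_feasible {R Arc}.
Arguments mip_objval {R Arc}.
Arguments mip_optsol {R Arc}.
Arguments decode {R Arc}.

(* Main.v *)
Require Import Defs.
From HB Require Import structures.
From mathcomp Require Import all_boot all_order all_algebra.
From mathcomp Require Import boolp classical_sets reals.
From mathcomp Require Import ring lra zify.
Import Order.TTheory GRing.Theory Num.Theory.
Local Open Scope ring_scope.

Set Implicit Arguments.
Unset Strict Implicit.
Unset Printing Implicit Defensive.

(** For a fixed first-stage path [X], linear programming duality replaces the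
    adversary's maximum over the budgeted set by a minimum over convex
    combinations of recovery paths [Y_i] and dual prices of the budget and of
    the deviation bounds. The adversary's problem has [m + 1] variables, so a
    basic dual solution, i.e. Farkas' lemma with linearly independent
    multipliers, needs only linearly many paths [Y_i], even though optimising
    over the neighbourhood may be NP-hard. Hence [X], the [Y_i], their weights
    and the prices can all be variables of one MIP: simple paths are integral
    unit flows with increasing potentials, and products of a weight with a
    binary variable are linearised. *)

(** * Farkas' lemma with linearly independent multipliers *)

(** Repeated indices share one multiplier, so this notion need not exclude duplicates; [uniq] is
    carried separately. *)
Definition lin_indep (R : pzRingType) (I : eqType) (J : Type)
    (a : I -> J -> R) (s : seq I) : Prop :=
  forall mu : I -> R, (forall j, \sum_(i <- s) mu i * a i j = 0) ->
    forall i, i \in s -> mu i = 0.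

Lemma lin_indep_size (R : fieldType) (I : eqType) (J : finType)
    (a : I -> J -> R) (s : seq I) :
  uniq s -> lin_indep a s -> (size s <= #|J|)%N.
Proof.
case: s => [|i0 s'] //; set s := i0 :: s' => us ind.
pose A : 'M[R]_(size s, #|J|) := \matrix_(k, j) a (nth i0 s k) (enum_val j).
suff /eqP <- : row_free A by exact: rank_leq_col.
rewrite -kermx_eq0; apply/eqP/row_matrixP => r; rewrite row0.
set v := row r _.
have vA : v *m A = 0 by rewrite /v -row_mul mulmx_ker row0.
(* A left-kernel vector, indexed by positions in [s], is turned into multipliers on [I]; uniqueness
   makes positions and indices correspond. *)
pose mu i := if insub (index i s) is Some k then v 0 k else 0.
have muE (k : 'I_(size s)) : mu (nth i0 s k) = v 0 k.
  by rewrite /mu index_uniq // insubT // => lt; congr (v 0 _); apply: val_inj.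
apply/rowP => k; rewrite [RHS]mxE -muE; apply: ind; last exact: mem_nth.
move=> j; rewrite (big_nth i0) big_mkord.
move/rowP: vA => /(_ (enum_rank j)); rewrite [LHS]mxE [RHS]mxE; apply: etrans.
by apply: eq_bigr => l _; rewrite muE [A l _]mxE enum_rankK.
Qed.

(* Bartl's induction: if the last inequality is needed, some [y] violates only
   it; eliminating along [y] preserves the hypothesis and independence. *)
Lemma farkas_lin_indep (R : realFieldType) (I : eqType) (J : finType)
    (s : seq I) (a : I -> J -> R) (c : J -> R) :
  uniq s ->
  (forall x : J -> R, (forall i, i \in s -> \sum_j a i j * x j <= 0) ->
    \sum_j c j * x j <= 0) ->
  exists (s' : seq I) (l : I -> R),
    [/\ uniq s', {subset s' <= s}, lin_indep a s',
        (forall i, 0 <= l i) &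
        forall j, c j = \sum_(i <- s') l i * a i j].
Proof.
elim: s a c => [|i0 s IH] a c.
  move=> _ H; exists [::], (fun=> 0); split => // j; rewrite big_nil.
  (* With no inequalities, testing at [x = c] forces the sum of squares of [c] to be 0. *)
  have := H c (fun i => ltac:(by [])).
  have sq i : 0 <= c i * c i by rewrite -expr2 sqr_ge0.
  rewrite le_eqVlt ltNge sumr_ge0 // orbF => /eqP /psumr_eq0P.
  by move/(_ (fun i _ => sq i) j isT)/eqP; rewrite mulf_eq0 orbb => /eqP.
move=> /= /andP[i0s us] H.
have [H0|] := pselect (forall x : J -> R,
    (forall i, i \in s -> \sum_j a i j * x j <= 0) -> \sum_j c j * x j <= 0).
  have [s' [l [us' ss' ind l0 cE]]] := IH a c us H0.
  by exists s', l; split => // i /ss' si; rewrite inE si orbT.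
move=> /existsNP[y0 /not_implyP[ay0 /negP]]; rewrite -ltNge => cy0.
have a0y0 : 0 < \sum_j a i0 j * y0 j.
  rewrite ltNge; apply/negP => le0; move: cy0; rewrite ltNge H // => i.
  by rewrite inE => /orP[/eqP->|/ay0].
pose dot (b x : J -> R) := \sum_j b j * x j.
pose y j := y0 j / dot (a i0) y0.
have dy b : dot b y = dot b y0 / dot (a i0) y0.
  by rewrite /dot mulr_suml; apply: eq_bigr => j _; rewrite mulrA.
have a0y : dot (a i0) y = 1 by rewrite dy divff // gt_eqF.
have ay i : i \in s -> dot (a i) y <= 0.
  by move=> si; rewrite dy pmulr_lle0 ?invr_gt0 //; exact: ay0.
have cy : 0 < dot c y by rewrite dy divr_gt0.
(* [red] makes a form vanish at [y]. It is adjoint to the projection along [y] onto the kernel of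
   [a i0], which turns any test point into one where the inequality [i0] holds with equality. *)
pose red b j := b j - dot b y * a i0 j.
have dred b x : dot (red b) x = dot b (fun j => x j - dot (a i0) x * y j).
  have -> : dot (red b) x = dot b x - dot b y * dot (a i0) x.
    rewrite {1 2 4}/dot mulr_sumr -sumrB; apply: eq_bigr => j _.
    by rewrite /red; ring.
  have -> : forall k, dot b (fun j => x j - k * y j) = dot b x - k * dot b y.
    by move=> k; rewrite /dot mulr_sumr -sumrB; apply: eq_bigr => j _; ring.
  by rewrite [dot b y * _]mulrC.
have a0red x : dot (a i0) (fun j => x j - dot (a i0) x * y j) = 0.
  rewrite -dred; rewrite /dot big1 // => j _.
  by rewrite /red a0y mul1r subrr mul0r.
have [|s' [l [us' ss' ind l0 cE]]] := IH (fun i => red (a i)) (red c) us.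
  move=> x Hx; rewrite -/(dot _ _) dred; apply: H => i.
  rewrite inE => /orP[/eqP->|si]; first by rewrite -/(dot _ _) a0red.
  by rewrite -/(dot _ _) -dred; exact: Hx.
have i0s' : i0 \notin s' by apply: contra i0s => /ss'.
have sumred (mu : I -> R) j : \sum_(i <- s') mu i * red (a i) j =
    \sum_(i <- s') mu i * a i j - (\sum_(i <- s') mu i * dot (a i) y) * a i0 j.
  rewrite mulr_suml -sumrB; apply: eq_bigr => i _; rewrite /red; ring.
(* Undoing the reduction collects all multiples of [a i0]. The result is nonnegative since [dot c y]
   is positive and each [dot (a i) y] is at most 0. *)
pose l' i := if i == i0 then dot c y - \sum_(i <- s') l i * dot (a i) y else l i.
exists (i0 :: s'), l'; split.
- by rewrite /= i0s'.
- by move=> i; rewrite !inE => /orP[->//|/ss' ->]; rewrite orbT.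
- move=> mu mu0.
  (* Pairing a dependence with [y] expresses [mu i0] through the other multipliers; substituting it
     yields a dependence among the reduced rows. *)
  have mu0y : mu i0 + \sum_(i <- s') mu i * dot (a i) y = 0.
    transitivity (\sum_j (\sum_(i <- i0 :: s') mu i * a i j) * y j); last first.
      by rewrite big1 // => j _; rewrite mu0 mul0r.
    under [RHS]eq_bigr do rewrite mulr_suml.
    rewrite exchange_big big_cons -[in LHS](mulr1 (mu i0)) -a0y /=.
    congr (_ + _); first by rewrite mulr_sumr; apply: eq_bigr => j _; ring.
    by apply: eq_bigr => i _; rewrite mulr_sumr; apply: eq_bigr => j _; ring.
  have mus' i : i \in s' -> mu i = 0.
    apply: ind => j; rewrite sumred; have := mu0 j; rewrite big_cons; apply: etrans.
    have /eqP := mu0y; rewrite addrC addr_eq0 => /eqP ->; ring.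
  move=> i; rewrite inE => /orP[/eqP->|/mus'//].
  move: mu0y; rewrite big_seq big1 ?addr0 // => j js.
  by rewrite mus' // mul0r.
- move=> i; rewrite /l'; case: eqP => // _.
  rewrite subr_ge0 (le_trans _ (ltW cy)) // big_seq sumr_le0 // => j /ss' /ay.
  by move=> ay1; rewrite mulr_ge0_le0.
- move=> j; rewrite big_cons /l' eqxx.
  have -> : \sum_(i <- s') (if i == i0 then dot c y -
      \sum_(i1 <- s') l i1 * dot (a i1) y else l i) * a i j =
      \sum_(i <- s') l i * a i j.
    rewrite big_seq [RHS]big_seq; apply: eq_bigr => i si.
    by case: eqP => // ii0; rewrite -ii0 si in i0s'.
  have := cE j; rewrite sumred /red => E.
  by rewrite -[LHS](subrK (dot c y * a i0 j)) E; ring.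
Qed.

(** * Simple paths as unit flows with potentials *)

Section PathSystem.
Variables (R : realType) (V Arc : finType) (src dst : Arc -> V).

Definition balance (e : Arc) (v : V) : R := (src e == v)%:R - (dst e == v)%:R.

Definition unit_flow (s t : V) (E : {set Arc}) : Prop :=
  forall v, \sum_(e in E) balance e v = (s == v)%:R - (t == v)%:R.

Lemma walk_balance (t v : V) (p : seq Arc) (s : V) :
  walk_to_t src dst t s p ->
  \sum_(e <- p) balance e v = (s == v)%:R - (t == v)%:R.
Proof.
elim: p s => [|e p IH] s /=; first by move/eqP->; rewrite big_nil subrr.
by move=> /andP[/eqP <- /IH]; rewrite big_cons /balance => ->; ring.
Qed.

Lemma stpath_flow (s t : V) (E : {set Arc}) :
  is_stpath src dst s t E -> unit_flow s t E.
Proof.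
move=> [p [w /= /andP[_ /map_uniq up] ->]] v; rewrite -(walk_balance v w).
by rewrite (big_uniq _ up); apply: eq_bigl => e; rewrite inE.
Qed.

(** The start gets 0 and every other vertex one more than its potential for the remaining walk.
    Strict increase survives because no arc re-enters the start. *)
Lemma walk_potential (t : V) (p : seq Arc) (s : V) :
  walk_to_t src dst t s p -> uniq (s :: map dst p) ->
  exists u : V -> nat, (forall v, u v <= size p)%N /\
    forall e, e \in p -> (u (src e) < u (dst e))%N.
Proof.
elim: p s => [|e p IH] s /=; first by move=> _ _; exists (fun=> 0%N).
move=> /andP[/eqP es w] /andP[sn ud].
have [u [ub us]] := IH _ w ud.
exists (fun v => if v == s then 0%N else (u v).+1); split.
  by move=> v; case: eqP => // _; rewrite ltnS.
move=> f; rewrite inE => fp; have fs : dst f != s.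
  apply: contra sn => /eqP <-; rewrite -(map_cons dst e p).
  by apply: map_f; rewrite inE.
rewrite (negbTE fs); case: eqP => // /eqP sf; rewrite ltnS.
by case/orP: fp => [/eqP fe|/us//]; rewrite fe es eqxx in sf.
Qed.

Lemma stpath_potential (s t : V) (E : {set Arc}) :
  is_stpath src dst s t E ->
  exists u : V -> nat, (forall v, u v < #|V|)%N /\
    forall e, e \in E -> (u (src e) < u (dst e))%N.
Proof.
move=> [p [w up ->]]; have [u [ub us]] := walk_potential w up.
exists u; split => [v|e]; last by rewrite inE; exact: us.
rewrite (leq_ltn_trans (ub v)) // -(size_map dst) -[X in (X <= _)%N]/(size (s :: map dst p)).
by rewrite -(card_uniqP up) max_card.
Qed.

Lemma walk_potential_lt (u : V -> R) (t : V) (p : seq Arc) (s : V) :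
  walk_to_t src dst t s p -> (forall e, e \in p -> u (src e) < u (dst e)) ->
  forall e, e \in p -> u s < u (dst e).
Proof.
elim: p s => //= f p IH s /andP[/eqP <- w] up e.
have uf : u (src f) < u (dst f) by apply: up; rewrite mem_head.
rewrite inE => /orP[/eqP->//|ep]; apply: lt_trans uf _.
by apply: IH ep => // g gp; apply: up; rewrite inE gp orbT.
Qed.

(** Removing an arc that leaves [s] gives a unit flow from its head to [t], so induction on the
    number of arcs applies. Once the source is [t], the rest is a circulation, which increasing
    potentials force to be empty. *)
Lemma flow_stpath (u : V -> R) (t : V) (E : {set Arc}) (s : V) :
  unit_flow s t E -> (forall e, e \in E -> u (src e) < u (dst e)) ->
  is_stpath src dst s t E.
Proof.
have [n] := ubnP #|E|; elim: n => // n IH in E s * => /ltnSE En fE uE.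
have [st|nst] := eqVneq s t.
  suff E0 : E = finset.set0.
    by exists [::]; rewrite /= st eqxx E0; split => //; apply/setP => e; rewrite !inE.
  apply/eqP; apply: contraT => /set0Pn[e0 e0E].
  (* No arc of [E] leaves a head of maximal potential, so the balance there is negative,
     contradicting conservation. *)
  pose e := [arg max_(f > e0 in E) u (dst f)]%O.
  have [eE emax] : e \in E /\ forall f, f \in E -> u (dst f) <= u (dst e).
    by rewrite /e; case: (Order.TotalTheory.arg_maxP (fun f => u (dst f)) e0E).
  have := fE (dst e); rewrite st subrr (big_setD1 e eE) /= => /eqP.
  rewrite lt_eqF // -[ltRHS]addr0; apply: ltr_leD; rewrite /balance.
    have := uE _ eE; case: (eqVneq (src e)) => [->|_ _]; first by rewrite ltxx.
    by rewrite eqxx sub0r oppr_lt0 ltr01.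
  rewrite sumr_le0 // => f; rewrite inE => /andP[_ fE'].
  case: eqP => [sf|_]; last by rewrite sub0r oppr_le0.
  by have := uE f fE'; rewrite sf ltNge emax.
have [e eE es] : exists2 e, e \in E & src e = s.
  apply: contrapT => noe; have /eqP := fE s.
  rewrite eqxx [t == s]eq_sym (negbTE nst) subr0 lt_eqF //.
  rewrite (le_lt_trans _ ltr01) // sumr_le0 // => e eE; rewrite /balance.
  by case: eqP => [es|_]; [case: noe; exists e | rewrite sub0r oppr_le0].
have [|||p [w up Ep]] := IH (E :\ e) (dst e).
- by rewrite [X in (X < _)%N]cardsE; move: En; rewrite (cardsD1 e) eE cardsE.
- by move=> v; have := fE v; rewrite (big_setD1 e eE) /= {1}/balance es; lra.
- by move=> f; rewrite inE => /andP[_ /uE].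
have EE f : (f \in E) = (f \in e :: p).
  have := eE; rewrite -(finset.setD1K eE) Ep !inE => _.
  by [].
exists (e :: p); split; last by apply/setP => f; rewrite EE inE.
  by rewrite /= es eqxx.
(* Every head along the walk has potential above [u s], so the walk never returns to [s]. *)
rewrite map_cons cons_uniq up andbT -map_cons; apply/negP => /mapP[f fp sf].
have w' : walk_to_t src dst t s (e :: p) by rewrite /= es eqxx.
have up' g : g \in e :: p -> u (src g) < u (dst g) by rewrite -EE => /uE.
by have := walk_potential_lt w' up' fp; rewrite -sf ltxx.
Qed.

End PathSystem.

(** * Duality for the budgeted uncertainty set *)

Section BudgetDuality.
Variables (R : realType) (Arc : finType) (ch D : Arc -> R) (G : R).

Lemma costE (c : Arc -> R) (Y : {set Arc}) :
  cost c Y = \sum_e c e * (e \in Y)%:R.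
Proof. by rewrite /cost big_mkcond; apply: eq_bigr => e _; case: ifP; rewrite ?mulr1 ?mulr0. Qed.

(** Replacing [w] by [al + b] against the excess [c - ch] leaves two terms: the budget bounds the
    total excess priced at [al], and [D] bounds each excess priced at [b]. *)
Lemma budget_weak_duality (c : Arc -> R) (w b : Arc -> R) (al : R) :
  Ucal ch D G c -> 0 <= al -> (forall e, 0 <= b e) ->
  (forall e, w e <= al + b e) ->
  \sum_e c e * w e <= \sum_e ch e * w e + G * al + \sum_e D e * b e.
Proof.
move=> [cU cG] al0 b0 wle; rewrite -addrA -lerBlDl -sumrB.
apply: le_trans (_ : (\sum_e (c e - ch e)) * al + \sum_e D e * b e <= _); last first.
  by rewrite lerD2r ler_wpM2r.
rewrite mulr_suml -big_split; apply: ler_sum => e _ /=.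
have /andP[c1 c2] := cU e; rewrite -mulrBl.
apply: le_trans (_ : (c e - ch e) * (al + b e) <= _).
  by rewrite ler_wpM2l // subr_ge0.
by rewrite mulrDr lerD2l ler_wpM2r // lerBlDl.
Qed.

(* Coordinates of the homogenised adversary problem, in the order
   [inl true] = value, [inl false] = scale, [inr e] = deviation on [e]. *)
Let coord : finType := (bool + Arc)%type.

(** In order: the value is at most the scaled cost of [Y]; the budget; nonnegative scale; the upper
    bound on each deviation; nonnegative deviations. *)
Let ineq : finType := ({set Arc} + (bool + (Arc + Arc)))%type.

Let row (i : ineq) (j : coord) : R :=
  match i, j with
  | inl Y, inl true => 1
  | inl Y, inl false => - cost ch Y
  | inl Y, inr e => - (e \in Y)%:R
  | inr (inl true), inl true => 0
  | inr (inl true), inl false => - G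
  | inr (inl true), inr _ => 1
  | inr (inl false), inl false => - 1
  | inr (inl false), _ => 0
  | inr (inr (inl f)), inl true => 0
  | inr (inr (inl f)), inl false => - D f
  | inr (inr (inl f)), inr e => (f == e)%:R
  | inr (inr (inr f)), inl _ => 0
  | inr (inr (inr f)), inr e => - (f == e)%:R
  end.

Let sum_delta (f : Arc) (x : Arc -> R) : \sum_e (f == e)%:R * x e = x f.
Proof.
rewrite (bigD1 f) //= eqxx mul1r big1 ?addr0 // => e ef.
by rewrite eq_sym (negbTE ef) mul0r.
Qed.

(** The hypothesis makes [value <= v * scale] a consequence of the homogenised system, so Farkas
    multipliers give path weights and prices. Independence bounds their number by the [#|Arc|.+2]
    coordinates. *)
Lemma budget_strong_duality (F : {set {set Arc}}) (v : R) :
  F != finset.set0 ->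
  (forall c, Ucal ch D G c -> exists2 Y, Y \in F & cost c Y <= v) ->
  exists (Y : 'I_(#|Arc|.+2) -> {set Arc}) (l : 'I_(#|Arc|.+2) -> R)
    (al : R) (b : Arc -> R),
    [/\ [/\ forall i, Y i \in F, forall i, 0 <= l i & \sum_i l i = 1],
        0 <= al, (forall e, 0 <= b e),
        (forall e, \sum_i l i * (e \in Y i)%:R <= al + b e) &
        \sum_e ch e * (\sum_i l i * (e \in Y i)%:R) + G * al
          + \sum_e D e * b e <= v].
Proof.
move=> /set0Pn[Y0 Y0F] vmax.
pose tgt (j : coord) : R :=
  match j with inl true => 1 | inl false => - v | inr _ => 0 end.
pose s := [seq i <- enum ineq | if i is inl Y then Y \in F else true].
have us : uniq s by rewrite filter_uniq // enum_uniq.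
have memF Y : (inl Y : ineq) \in s = (Y \in F) by rewrite mem_filter mem_enum andbT.
have memr i : (inr i : ineq) \in s by rewrite mem_filter mem_enum.
have [|s' [l0 [us' ss' /(lin_indep_size us') sz l00 tgtE]]] :=
    @farkas_lin_indep R ineq coord s row tgt us.
  move=> x Hx; rewrite big_sumType big_bool /= mul1r big1 ?addr0; last first.
    by move=> e _; rewrite mul0r.
  set th := x (inl true); set ta := x (inl false).
  have HF Y : Y \in F -> th <= cost ch Y * ta + \sum_(e in Y) x (inr e).
    rewrite -memF => /Hx; rewrite big_sumType big_bool /= -/th -/ta.
    have -> : \sum_e - (e \in Y)%:R * x (inr e) = - \sum_(e in Y) x (inr e).
      rewrite [in RHS]big_mkcond -sumrN; apply: eq_bigr => e _.
      by case: ifP => _; rewrite mulNr ?mul1r ?mul0r.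
    lra.
  have HG : \sum_e x (inr e) <= G * ta.
    have := Hx _ (memr (inl true)); rewrite big_sumType big_bool /= -/ta.
    under eq_bigr do rewrite mul1r.
    lra.
  have Hta : 0 <= ta.
    have := Hx _ (memr (inl false)); rewrite big_sumType big_bool /= -/ta.
    rewrite big1 => [|e _]; last by rewrite mul0r.
    lra.
  have Hup e : x (inr e) <= D e * ta.
    have := Hx _ (memr (inr (inl e))); rewrite big_sumType big_bool /= -/ta.
    rewrite (sum_delta e (fun f => x (inr f))); lra.
  have Hlo e : 0 <= x (inr e).
    have := Hx _ (memr (inr (inr e))); rewrite big_sumType big_bool /=.
    under eq_bigr do rewrite mulNr.
    rewrite sumrN (sum_delta e (fun f => x (inr f))); lra.
  (* At scale 0 all deviations vanish, and the row of [Y0] bounds the value by 0. A positive scale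
     can be divided out to give a genuine scenario. *)
  have [ta0|tan0] := eqVneq ta 0.
    rewrite ta0 mulr0 addr0 (le_trans (HF _ Y0F)) // ta0 mulr0 add0r.
    by rewrite sumr_le0 // => e _; have := Hup e; rewrite ta0 mulr0.
  have tap : 0 < ta by rewrite lt_def tan0.
  pose c e := ch e + x (inr e) / ta.
  have [|Y YF cY] := vmax c.
    split => [e|].
      by rewrite /c lerDl lerD2l divr_ge0 ?Hlo //= ler_pdivrMr.
    have -> : \sum_e (c e - ch e) = (\sum_e x (inr e)) / ta.
      by rewrite mulr_suml; apply: eq_bigr => e _; rewrite /c; ring.
    by rewrite ler_pdivrMr.
  rewrite mulNr subr_le0 (le_trans (HF _ YF)) //.
  have -> : cost ch Y * ta + \sum_(e in Y) x (inr e) = cost c Y * ta.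
    rewrite /cost !mulr_suml -big_split; apply: eq_bigr => e _ /=.
    by rewrite /c mulrDl divfK.
  by rewrite ler_wpM2r.
pose l i := if i \in s' then l0 i else 0.
have lge i : 0 <= l i by rewrite /l; case: ifP.
have lE j : tgt j = \sum_i l i * row i j.
  rewrite tgtE (big_uniq _ us') big_mkcond; apply: eq_bigr => i _ /=.
  by rewrite /l; case: ifP; rewrite ?mul0r.
pose N := #|Arc|.+2.
pose ys := [seq Y <- index_enum {set Arc} | (inl Y : ineq) \in s'].
have szys : (size ys <= N)%N.
  have -> : N = #|coord| by rewrite /N card_sum card_bool.
  rewrite (leq_trans _ sz) // -(size_map (fun Y => inl Y : ineq)).
  rewrite uniq_leq_size ?map_inj_uniq ?filter_uniq ?index_enum_uniq //.
    by move=> ? ? [].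
  by move=> i /mapP[Y]; rewrite mem_filter => /andP[iY _] ->.
(* Slots beyond the end of [ys] are padded with [Y0] at weight 0. *)
pose Yf (i : 'I_N) := nth Y0 ys i.
pose lf (i : 'I_N) := if (i < size ys)%N then l (inl (Yf i)) else 0.
have sumY (g : {set Arc} -> R) : \sum_i lf i * g (Yf i) = \sum_Y l (inl Y) * g Y.
  have -> : \sum_Y l (inl Y) * g Y = \sum_(Y <- ys) l (inl Y) * g Y.
    rewrite big_filter [RHS]big_mkcond; apply: eq_bigr => Y _ /=.
    by rewrite /l; case: ifP; rewrite ?mul0r.
  rewrite (big_nth Y0) big_mkord.
  rewrite (big_ord_widen N (fun i => l (inl (nth Y0 ys i)) * g (nth Y0 ys i)) szys).
  rewrite [RHS]big_mkcond; apply: eq_bigr => i _.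
  by rewrite /lf; case: ifP => _; rewrite ?mul0r.
(* In the Farkas identity, the value coordinate says that the weights sum to 1, the deviation
   coordinates give the covering inequalities, and the scale coordinate gives the bound by [v].
   Multipliers of the sign rows act as slacks. *)
pose al := l (inr (inl true)); pose b e := l (inr (inr (inl e))).
exists Yf, lf, al, b; split.
- split.
  + move=> i; rewrite /Yf; have [iy|iy] := ltnP i (size ys); last by rewrite nth_default.
    have : nth Y0 ys i \in ys by rewrite mem_nth.
    by rewrite mem_filter => /andP[/ss']; rewrite memF.
  + by move=> i; rewrite /lf; case: ifP.
  + have := lE (inl true); rewrite !big_sumType big_bool /=.
    have -> : \sum_i lf i = \sum_Y l (inl Y) * 1.
      by rewrite -(sumY (fun=> 1)); apply: eq_bigr => i _; rewrite mulr1.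
    rewrite [X in _ + (_ + (X + _))]big1 => [|e _]; last by rewrite mulr0.
    rewrite [X in _ + (_ + (_ + X))]big1 => [|e _]; last by rewrite mulr0.
    lra.
- exact: lge.
- by move=> e; exact: lge.
- move=> e; rewrite (sumY (fun Y => (e \in Y)%:R)).
  have := lE (inr e); rewrite !big_sumType big_bool /= -/al.
  under eq_bigr do rewrite mulrN.
  under [X in _ + (_ + (X + _))]eq_bigr do rewrite mulrC eq_sym.
  under [X in _ + (_ + (_ + X))]eq_bigr do rewrite mulrN mulrC eq_sym.
  rewrite !sumrN (sum_delta e b) (sum_delta e (fun e => l (inr (inr (inr e))))).
  have := lge (inr (inr (inr e))); lra.
have -> : \sum_e ch e * (\sum_i lf i * (e \in Yf i)%:R) = \sum_Y l (inl Y) * cost ch Y.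
  rewrite -(sumY (cost ch)).
  under eq_bigr do rewrite mulr_sumr.
  rewrite exchange_big; apply: eq_bigr => i _ /=.
  by rewrite costE mulr_sumr; apply: eq_bigr => e _; ring.
have := lE (inl false); rewrite !big_sumType big_bool /= -/al.
under eq_bigr do rewrite mulrN.
under [X in _ + (_ + (X + _))]eq_bigr do rewrite mulrN mulrC.
rewrite [X in _ + (_ + (_ + X))]big1 => [|e _]; last by rewrite mulr0.
rewrite !sumrN.
have := lge (inr (inl false)); lra.
Qed.

End BudgetDuality.

(** * Linear systems as mixed integer programs *)

Section LinearSystems.
Variables (R : realType) (Var : finType).
Implicit Types (f g : (Var -> R) -> R) (P Q : (Var -> R) -> Prop).

Definition linear_form f : Prop :=
  exists a : Var -> R, forall z, f z = \sum_j a j * z j.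

Lemma linear_form_var j : linear_form (fun z => z j).
Proof.
exists (fun i => (i == j)%:R) => z; rewrite (bigD1 j) //= eqxx mul1r.
by rewrite big1 ?addr0 // => i /negbTE ->; rewrite mul0r.
Qed.

Lemma linear_formD f g :
  linear_form f -> linear_form g -> linear_form (fun z => f z + g z).
Proof.
move=> [a fE] [b gE]; exists (fun j => a j + b j) => z.
by rewrite fE gE -big_split; apply: eq_bigr => j _; rewrite mulrDl.
Qed.

Lemma linear_formZ r f : linear_form f -> linear_form (fun z => r * f z).
Proof.
move=> [a fE]; exists (fun j => r * a j) => z.
by rewrite fE mulr_sumr; apply: eq_bigr => j _; rewrite mulrA.
Qed.

Lemma linear_formN f : linear_form f -> linear_form (fun z => - f z).
Proof.
by case/(linear_formZ (-1)) => a fE; exists a => z; rewrite -fE mulN1r.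
Qed.

Lemma linear_form_sum (I : finType) (f : I -> (Var -> R) -> R) :
  (forall i, linear_form (f i)) -> linear_form (fun z => \sum_i f i z).
Proof.
move=> /choice[a fE]; exists (fun j => \sum_i a i j) => z.
under eq_bigr do rewrite fE.
by rewrite exchange_big; apply: eq_bigr => j _; rewrite mulr_suml.
Qed.

(** The index counts inequalities, so the closure lemmas compute the size of the program. *)
Definition polyhedral (n : nat) P : Prop :=
  exists (a : 'I_n -> Var -> R) (b : 'I_n -> R),
    forall z, P z <-> forall i, \sum_j a i j * z j <= b i.

Lemma polyhedral_fintype (Con : finType) (a : Con -> Var -> R) (b : Con -> R) P :
  (forall z, P z <-> forall i, \sum_j a i j * z j <= b i) ->
  polyhedral #|Con| P.
Proof.
move=> PE; exists (fun i => a (enum_val i)), (fun i => b (enum_val i)) => z.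
by rewrite PE; split => H i //; rewrite -(enum_rankK i).
Qed.

Lemma polyhedral_le f b : linear_form f -> polyhedral 1 (fun z => f z <= b).
Proof.
move=> [a fE]; exists (fun=> a), (fun=> b) => z; rewrite fE.
by split => // /(_ ord0).
Qed.

Lemma polyhedral_and n m P Q : polyhedral n P -> polyhedral m Q ->
  polyhedral (n + m) (fun z => P z /\ Q z).
Proof.
move=> [a [b PE]] [a' [b' QE]].
have -> : (n + m)%N = #|{: 'I_n + 'I_m}| by rewrite card_sum !card_ord.
apply: (@polyhedral_fintype _
  (fun i => match i with inl i => a i | inr i => a' i end)
  (fun i => match i with inl i => b i | inr i => b' i end)) => z.
rewrite PE QE; split => [[H1 H2] [] //|H].
by split => i; [have := H (inl i) | have := H (inr i)].
Qed.

Lemma polyhedral_eq f b : linear_form f -> polyhedral 2 (fun z => f z = b).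
Proof.
move=> lf; have [a [c H]] := polyhedral_and (polyhedral_le b lf)
  (polyhedral_le (- b) (linear_formN lf)).
exists a, c => z; rewrite -H lerN2; split => [->//|[le ge]].
by apply/le_anti; rewrite le ge.
Qed.

Lemma polyhedral_forall (T : finType) n (P : T -> (Var -> R) -> Prop) :
  (forall t, polyhedral n (P t)) ->
  polyhedral (#|T| * n) (fun z => forall t, P t z).
Proof.
move=> /choice[a /choice[b PE]].
have -> : (#|T| * n)%N = #|{: T * 'I_n}| by rewrite card_prod card_ord.
apply: (@polyhedral_fintype _ (fun i => a i.1 i.2) (fun i => b i.1 i.2)) => z.
split => [H [t i]|H t]; first by have /PE := H t; exact.
by apply/PE => i; exact: (H (t, i)).
Qed.

Variable Arc : finType.

(** The coefficients are fixed before the cost data, which enter only through [eval_aff]; one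
    program thus serves all data. *)
Definition objective_form
    (h : (Arc -> R) -> (Arc -> R) -> (Arc -> R) -> R -> (Var -> R) -> R) : Prop :=
  exists o : Var -> affd R Arc, forall C ch D G z,
    h C ch D G z = \sum_j eval_aff (o j) C ch D G * z j.

Lemma objective_formD h1 h2 : objective_form h1 -> objective_form h2 ->
  objective_form (fun C ch D G z => h1 C ch D G z + h2 C ch D G z).
Proof.
move=> [o1 h1E] [o2 h2E].
exists (fun j => Affd R Arc (a0 _ _ (o1 j) + a0 _ _ (o2 j))
  (fun e => aC _ _ (o1 j) e + aC _ _ (o2 j) e)
  (fun e => aH _ _ (o1 j) e + aH _ _ (o2 j) e)
  (fun e => aD _ _ (o1 j) e + aD _ _ (o2 j) e)
  (aG _ _ (o1 j) + aG _ _ (o2 j))) => C ch D G z.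
rewrite h1E h2E -big_split; apply: eq_bigr => j _ /=.
rewrite -mulrDl; congr (_ * _); rewrite /eval_aff /=.
set S1 := \sum_e _; set S2 := \sum_e _; set S := \sum_e _.
have -> : S = S1 + S2 by rewrite -big_split; apply: eq_bigr => e _ /=; ring.
by ring.
Qed.

Lemma objective_form_term (a : affd R Arc) (j : Var) :
  objective_form (fun C ch D G z => eval_aff a C ch D G * z j).
Proof.
exists (fun i => if i == j then a else
  Affd R Arc 0 (fun=> 0) (fun=> 0) (fun=> 0) 0) => C ch D G z.
rewrite (bigD1 j) //= eqxx big1 ?addr0 // => i /negbTE ->.
rewrite {1}/eval_aff /= big1 => [|e _]; first by ring.
by ring.
Qed.

Lemma objective_form_sum (I : finType) (h : I -> (Arc -> R) -> (Arc -> R) ->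
    (Arc -> R) -> R -> (Var -> R) -> R) :
  (forall i : I, objective_form (h i)) ->
  objective_form (fun C ch D G z => \sum_i h i C ch D G z).
Proof.
move=> H.
suff K (r : seq I) : objective_form (fun C ch D G z => \sum_(i <- r) h i C ch D G z).
  exact: K.
elim: r => [|i r [o IH]].
  exists (fun=> Affd R Arc 0 (fun=> 0) (fun=> 0) (fun=> 0) 0) => C ch D G z.
  rewrite big_nil big1 // => j _.
  by rewrite /eval_aff /= big1 => [|e _]; ring.
have [o' oE] := objective_formD (H i) (ex_intro _ o (fun _ _ _ _ _ => erefl)).
by exists o' => C ch D G z; rewrite big_cons IH -oE.
Qed.

Lemma mip_of_polyhedral n P (I : pred Var) h :
  polyhedral n P -> objective_form h ->
  exists (M : MIP R Arc) (iota : Var -> 'I_(nvars M)) (kappa : 'I_(nvars M) -> Var),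
    [/\ nvars M = #|Var| /\ nconstr M = n, cancel iota kappa, cancel kappa iota,
        forall j, intv M (iota j) = I j &
        forall C ch D G z,
          (mip_feasible M C ch D G z <->
            (forall j, I j -> exists m : int, z (iota j) = m%:~R) /\
            P (fun j => z (iota j))) /\
          mip_objval M C ch D G z = h C ch D G (fun j => z (iota j))].
Proof.
move=> [a [b PE]] [o hE].
pose cst r := Affd R Arc r (fun=> 0) (fun=> 0) (fun=> 0) 0.
have cstE r C ch D G : eval_aff (cst r) C ch D G = r.
  rewrite /eval_aff /= mul0r addr0 big1 ?addr0 // => e _.
  by rewrite !mul0r !addr0.
exists (Mip R Arc #|Var| n (fun j => I (enum_val j))
  (fun i j => cst (a i (enum_val j))) (fun i => cst (b i)) (fun j => o (enum_val j))).
have sumE (F : Var -> R) (z : 'I_#|Var| -> R) :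
    \sum_j F j * z (enum_rank j) = \sum_j F (enum_val j) * z j.
  rewrite (reindex (@enum_rank Var)) /=; last first.
    by exists enum_val => j _; rewrite ?enum_rankK ?enum_valK.
  by apply: eq_bigr => j _; rewrite enum_rankK.
exists (@enum_rank Var), enum_val; split => //=.
- exact: enum_rankK.
- exact: enum_valK.
- by move=> j; rewrite enum_rankK.
move=> C ch D G z; split; last by rewrite hE sumE.
rewrite /mip_feasible /= PE; split => -[H1 H2]; split.
- by move=> j Ij; apply: H1; rewrite enum_rankK.
- by move=> i; have := H2 i; rewrite cstE sumE; under eq_bigr do rewrite cstE.
- by move=> j Ij; have := H1 _ Ij; rewrite enum_valK.
- by move=> i; have := H2 i; rewrite cstE sumE; under [in X in _ -> X]eq_bigr do rewrite cstE.
Qed.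

End LinearSystems.

(** * The formulation *)

Section Formulation.
Variables (R : realType) (V Arc : finType) (src dst : Arc -> V) (s t : V).
Variables (k : nat) (nb : nbhd).

Let N := #|Arc|.+2.

(* Path [None] is the first-stage path [X]; path [Some i] is the [i]-th recovery
   path [Y_i] of the convex combination. *)
Let path_index := option 'I_N.

Definition mip_var : finType :=
  (path_index * Arc + (path_index * V + ('I_N + ('I_N * Arc +
    ('I_N * Arc + ('I_N * Arc + (unit + Arc)))))))%type.

Definition arc_var (a : path_index) (e : Arc) : mip_var := inl (a, e).
Definition pot_var (a : path_index) (v : V) : mip_var := inr (inl (a, v)).
Definition weight_var (i : 'I_N) : mip_var := inr (inr (inl i)).
Definition load_var (i : 'I_N) (e : Arc) : mip_var := inr (inr (inr (inl (i, e)))).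
Definition add_var (i : 'I_N) (e : Arc) : mip_var :=
  inr (inr (inr (inr (inl (i, e))))).
Definition del_var (i : 'I_N) (e : Arc) : mip_var :=
  inr (inr (inr (inr (inr (inl (i, e)))))).
Definition budget_var : mip_var := inr (inr (inr (inr (inr (inr (inl tt)))))).
Definition dev_var (e : Arc) : mip_var :=
  inr (inr (inr (inr (inr (inr (inr e)))))).

(** The three neighbourhoods become one weighted count: arcs of [Y :\: X] weigh [add_weight], arcs
    of [X :\: Y] weigh [del_weight]. *)
Definition add_weight : nat := if nb is Excl then 0 else 1.
Definition del_weight : nat := if nb is Incl then 0 else 1.

Definition is_arc_var (j : mip_var) : bool := if j is inl _ then true else false.

(* Unit flow with Miller-Tucker-Zemlin potentials, which exclude cycles. *)
Definition path_constr (a : path_index) (z : mip_var -> R) : Prop :=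
  (forall e, - z (arc_var a e) <= 0) /\
  (forall e, z (arc_var a e) <= 1) /\
  (forall v, \sum_e balance R src dst e v * z (arc_var a e)
     = (s == v)%:R - (t == v)%:R) /\
  (forall e, z (pot_var a (src e)) + - z (pot_var a (dst e))
     + #|V|%:R * z (arc_var a e) <= #|V|%:R - 1).

(* [load_var i e] linearises [weight * arc]; only the lower bound matters,
   because loads are minimised. *)
Definition weight_constr (z : mip_var -> R) : Prop :=
  (forall i, - z (weight_var i) <= 0) /\
  \sum_i z (weight_var i) = 1 /\
  (forall i e, - z (load_var i e) <= 0) /\
  (forall i e, z (weight_var i) + z (arc_var (Some i) e) + - z (load_var i e) <= 1).

(** Continuous variables dominate the indicators of added and deleted arcs; lower bounds suffice
    because their weighted total is bounded above. *)
Definition nbhd_constr (i : 'I_N) (z : mip_var -> R) : Prop :=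
  (forall e, - z (add_var i e) <= 0) /\
  (forall e, - z (del_var i e) <= 0) /\
  (forall e, z (arc_var (Some i) e) + - z (arc_var None e) + - z (add_var i e) <= 0) /\
  (forall e, z (arc_var None e) + - z (arc_var (Some i) e) + - z (del_var i e) <= 0) /\
  \sum_e (add_weight%:R * z (add_var i e) + del_weight%:R * z (del_var i e)) <= k%:R.

(* Dual of the adversary's problem of spreading the budget over the loads. *)
Definition dual_constr (z : mip_var -> R) : Prop :=
  - z budget_var <= 0 /\
  (forall e, - z (dev_var e) <= 0) /\
  (forall e, \sum_i z (load_var i e) + - z budget_var + - z (dev_var e) <= 0).

Definition mip_constr (z : mip_var -> R) : Prop :=
  (forall a, path_constr a z) /\ weight_constr z /\
  (forall i, nbhd_constr i z) /\ dual_constr z.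

Definition mip_cost (C ch D : Arc -> R) (G : R) (z : mip_var -> R) : R :=
  \sum_e C e * z (arc_var None e) + \sum_e \sum_i ch e * z (load_var i e)
  + G * z budget_var + \sum_e D e * z (dev_var e).

Ltac linear_form_tac :=
  repeat first [ exact: linear_form_var | apply: linear_formD | apply: linear_formN
    | apply: linear_formZ | apply: linear_form_sum => ? ].

Ltac polyhedral_tac :=
  repeat first [ apply: polyhedral_and | apply: polyhedral_forall => ?
    | apply: polyhedral_eq | apply: polyhedral_le ]; linear_form_tac.

Lemma mip_constr_polyhedral :
  exists2 n, (n <= 100 * (#|V| + #|Arc|).+1 ^ 2)%N & polyhedral n mip_constr.
Proof.
(* The count stays open until [polyhedral_tac] has built it from the constraints. *)
eexists; last first.
  by rewrite /mip_constr /path_constr /weight_constr /nbhd_constr /dual_constr; polyhedral_tac.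
by rewrite /= card_option card_ord /N; move: #|V| #|Arc| => v m; rewrite !expnS expn0; nia.
Qed.

Lemma card_mip_var : (#|mip_var| <= 100 * (#|V| + #|Arc|).+1 ^ 2)%N.
Proof.
rewrite !card_sum !card_prod card_option card_ord card_unit /N.
by move: #|V| #|Arc| => v m; rewrite !expnS expn0; nia.
Qed.

Lemma mip_cost_objective : objective_form mip_cost.
Proof.
have eval_delta (h : Arc -> R) e : \sum_f (f == e)%:R * h f = h e.
  rewrite (bigD1 e) //= eqxx mul1r big1 ?addr0 // => f /negbTE ->.
  by rewrite mul0r.
have tC (e : Arc) j : objective_form (fun (C ch D : Arc -> R) G (z : mip_var -> R) => C e * z j).
  have [o oE] := objective_form_term
    (Affd R Arc 0 (fun f => (f == e)%:R) (fun=> 0) (fun=> 0) 0) j.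
  exists o => C ch D G z; rewrite -oE /eval_aff /= mul0r add0r addr0.
  by under [in RHS]eq_bigr do rewrite !mul0r !addr0; rewrite eval_delta.
have tH (e : Arc) j : objective_form (fun (C ch D : Arc -> R) G (z : mip_var -> R) => ch e * z j).
  have [o oE] := objective_form_term
    (Affd R Arc 0 (fun=> 0) (fun f => (f == e)%:R) (fun=> 0) 0) j.
  exists o => C ch D G z; rewrite -oE /eval_aff /= mul0r add0r addr0.
  by under [in RHS]eq_bigr do rewrite !mul0r !addr0 add0r; rewrite eval_delta.
have tD (e : Arc) j : objective_form (fun (C ch D : Arc -> R) G (z : mip_var -> R) => D e * z j).
  have [o oE] := objective_form_term
    (Affd R Arc 0 (fun=> 0) (fun=> 0) (fun f => (f == e)%:R) 0) j.
  exists o => C ch D G z; rewrite -oE /eval_aff /= mul0r add0r addr0.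
  by under [in RHS]eq_bigr do rewrite !mul0r !add0r; rewrite eval_delta.
have tG j : objective_form (fun (C ch D : Arc -> R) G (z : mip_var -> R) => G * z j).
  have [o oE] := objective_form_term
    (Affd R Arc 0 (fun=> 0) (fun=> 0) (fun=> 0) 1) j.
  exists o => C ch D G z; rewrite -oE /eval_aff /= mul1r big1 ?add0r // => e _.
  by rewrite !mul0r !addr0.
rewrite /mip_cost; apply: objective_formD; last by apply: objective_form_sum => e.
apply: objective_formD => //; apply: objective_formD.
  by apply: objective_form_sum => e.
by apply: objective_form_sum => e; apply: objective_form_sum.
Qed.

(** * Decoding integral feasible points *)

Definition arcs_of (z : mip_var -> R) (a : path_index) : {set Arc} :=
  [set e | z (arc_var a e) == 1].

Lemma int_unit_interval (x : R) : (exists m : int, x = m%:~R) -> - x <= 0 ->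
  x <= 1 -> x = (x == 1)%:R.
Proof.
move=> [m ->]; rewrite oppr_le0 ler0z lerz1 => m0 m1.
by case: m m0 m1 => [[|[|n]]|n] //= _ _; rewrite ?eqxx // eq_sym oner_eq0.
Qed.

Lemma path_constr_sound (z : mip_var -> R) (a : path_index) :
  (forall e, exists m : int, z (arc_var a e) = m%:~R) -> path_constr a z ->
  is_stpath src dst s t (arcs_of z a) /\
  forall e, z (arc_var a e) = (e \in arcs_of z a)%:R.
Proof.
move=> zint [z0 [z1 [flow mtz]]].
have zE e : z (arc_var a e) = (e \in arcs_of z a)%:R.
  by rewrite inE; exact: int_unit_interval.
split=> //; apply: (@flow_stpath R _ _ _ _ (fun v => z (pot_var a v))) => [v|e ea].
  rewrite -flow [LHS]big_mkcond; apply: eq_bigr => e _.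
  by rewrite zE; case: ifP; rewrite ?mulr1 ?mulr0.
(* On a chosen arc the constraint forces the potential to rise by at least 1. *)
by have := mtz e; rewrite zE ea mulr1; lra.
Qed.

Lemma nbhd_weightsP (X Y : {set Arc}) :
  (match nb with
   | Incl => (#|Y :\: X| <= k)%N : Prop
   | Excl => (#|X :\: Y| <= k)%N
   | Sym  => (#|(Y :\: X) :|: (X :\: Y)| <= k)%N
   end) <-> (\sum_e (add_weight%:R * (e \in Y :\: X)%:R
          + del_weight%:R * (e \in X :\: Y)%:R) <= k%:R :> R).
Proof.
have cardE (A : {set Arc}) : \sum_e (e \in A)%:R = #|A|%:R :> R.
  by rewrite -natr_sum -sum1_card [in RHS]big_mkcond.
rewrite big_split /= -!mulr_sumr !cardE -!natrM -natrD ler_nat.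
rewrite /add_weight /del_weight; case: nb; rewrite ?mul1n ?mul0n ?addn0 //.
rewrite cardsU (_ : _ :&: _ = finset.set0) ?cards0 ?subn0 //.
by apply/setP => e; rewrite !inE; case: (e \in X) => /=; rewrite ?andbF.
Qed.

Lemma nbhd_constr_sound (z : mip_var -> R) (i : 'I_N) (X Y : {set Arc}) :
  (forall e, z (arc_var None e) = (e \in X)%:R) ->
  (forall e, z (arc_var (Some i) e) = (e \in Y)%:R) ->
  is_stpath src dst s t Y -> nbhd_constr i z -> in_nbhd src dst s t nb X k Y.
Proof.
move=> zX zY Yp [p0 [q0 [pz [qz pq]]]]; split => //; apply/nbhd_weightsP.
apply: le_trans pq; apply: ler_sum => e _; rewrite !inE.
have := p0 e; have := q0 e; have := pz e; have := qz e; rewrite !zX !zY.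
by case: (e \in X) (e \in Y) => [] [] /= *; apply: lerD; apply: ler_wpM2l => //; lra.
Qed.

(** * Soundness and completeness for fixed cost data *)

Section Instance.
Variables (C ch D : Arc -> R) (G : R).
Hypotheses (ch0 : forall e, 0 <= ch e).
Hypotheses (D0 : forall e, 0 <= D e) (G0 : 0 <= G).

Let obj := rrsp_obj src dst s t nb k C ch D G.

Lemma nominal_Ucal : Ucal ch D G ch.
Proof.
split => [e|]; first by rewrite lexx lerDl D0.
by rewrite big1 // => e _; rewrite subrr.
Qed.

(** In every scenario the best recovery costs at most the weighted average over the decoded [Y_i];
    weak duality bounds this average by the prices. *)
Lemma mip_cost_sound (z : mip_var -> R) :
  (forall j, is_arc_var j -> exists m : int, z j = m%:~R) -> mip_constr z ->
  is_stpath src dst s t (arcs_of z None) /\ obj (arcs_of z None) <= mip_cost C ch D G z.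
Proof.
move=> zint [zpath [zw [znb zdual]]].
have path_ok a := path_constr_sound (fun e => zint (arc_var a e) isT) (zpath a).
have [Xp XE] := path_ok None; split => //.
have nbY i : in_nbhd src dst s t nb (arcs_of z None) k (arcs_of z (Some i)).
  have [Yp YE] := path_ok (Some i).
  exact: (nbhd_constr_sound XE YE Yp (znb i)).
case: zw => l0 [l1 [w0 wl]]; case: zdual => al0 [b0 wab].
rewrite /mip_cost -!addrA lerD //.
  rewrite costE; apply: ler_sum => e _; by rewrite XE.
apply: ge_sup; first by exists (recov src dst s t nb k (arcs_of z None) ch);
  exists ch => //; exact: nominal_Ucal.
move=> _ [c cU <-].
pose w e := \sum_i z (load_var i e).
have -> : \sum_e \sum_i ch e * z (load_var i e) = \sum_e ch e * w e.
  by apply: eq_bigr => e _; rewrite mulr_sumr.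
rewrite addrA; apply: le_trans (budget_weak_duality cU _ _ _); first last.
- by move=> e; have := wab e; rewrite /w; lra.
- by move=> e; have := b0 e; lra.
- by lra.
have recovY i : recov src dst s t nb k (arcs_of z None) c <= cost c (arcs_of z (Some i)).
  by apply: bigmin_le_cond; apply/asboolP; exact: nbY.
rewrite -[leLHS]mul1r -l1 mulr_suml.
apply: le_trans (_ : \sum_i z (weight_var i) * cost c (arcs_of z (Some i)) <= _).
  by apply: ler_sum => i _; rewrite ler_wpM2l // -oppr_le0.
under eq_bigr do rewrite costE mulr_sumr.
rewrite exchange_big; apply: ler_sum => e _ /=.
rewrite /w mulr_sumr; apply: ler_sum => i _.
have [ce _] := cU; have /andP[c1 _] := ce e.
(* Scenario costs are nonnegative, so overestimating a product of weight and arc by its load only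
   raises the bound. *)
rewrite mulrCA ler_wpM2l ?(le_trans (ch0 e)) //.
have := wl i e; have [_ ->] := path_ok (Some i); have := w0 i e.
by case: (e \in _) => /= H1 H2; rewrite ?mulr1 ?mulr0; lra.
Qed.

(** Strong duality, applied to all neighbours of [X] with [v] the worst-case recovery cost, supplies
    the paths, weights and prices of a feasible point. *)
Lemma mip_cost_complete (X : {set Arc}) : is_stpath src dst s t X ->
  exists z : mip_var -> R,
    [/\ forall j, is_arc_var j -> exists m : int, z j = m%:~R,
        mip_constr z, arcs_of z None = X & mip_cost C ch D G z <= obj X].
Proof.
move=> Xp.
pose F := [set Y : {set Arc} | `[< in_nbhd src dst s t nb X k Y >]].
have XF : X \in F.
  rewrite inE; apply/asboolP; split => //.
  by case: nb; rewrite ?finset.setDv ?finset.setU0 cards0.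
pose v := sup [set recov src dst s t nb k X c | c in Ucal ch D G].
(* Keeping [X] at full deviations bounds every recovery cost, so the supremum really is an upper
   bound. *)
have bnd : has_ubound [set recov src dst s t nb k X c | c in Ucal ch D G].
  exists (cost (fun e => ch e + D e) X) => _ [c [cU _] <-].
  apply: le_trans (bigmin_le_id _ _ _ _) _; apply: ler_sum => e _.
  by have /andP[] := cU e.
have [||Y [l [al [b [[YF l0 l1] al0 b0 wab val]]]]] :=
    @budget_strong_duality R Arc ch D G F v.
- by apply/set0Pn; exists X.
- move=> c cU; have : recov src dst s t nb k X c <= v.
    by apply: ub_le_sup => //; exists c.
  case/bigmin_leP => [?|[Y PY ?]]; first by exists X.
  by exists Y => //; rewrite inE.
have Ynb i : in_nbhd src dst s t nb X k (Y i).
  by have := YF i; rewrite inE => /asboolP.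
pose E (a : path_index) := if a is Some i then Y i else X.
have Ep a : is_stpath src dst s t (E a) by case: a => [i|] //=; case: (Ynb i).
have /choice[u uP] a := stpath_potential (Ep a).
pose z (j : mip_var) : R :=
  match j with
  | inl (a, e) => (e \in E a)%:R
  | inr (inl (a, x)) => (u a x)%:R
  | inr (inr (inl i)) => l i
  | inr (inr (inr (inl (i, e)))) => l i * (e \in Y i)%:R
  | inr (inr (inr (inr (inl (i, e))))) => (e \in Y i :\: X)%:R
  | inr (inr (inr (inr (inr (inl (i, e)))))) => (e \in X :\: Y i)%:R
  | inr (inr (inr (inr (inr (inr (inl _)))))) => al
  | inr (inr (inr (inr (inr (inr (inr e)))))) => b e
  end.
exists z; split.
- by case=> [[a e] _|[]] //; exists (e \in E a)%:Z.
- split; last split; last split.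
  + move=> a; split; last split; last split => /=.
    * by move=> e /=; rewrite oppr_le0.
    * by move=> e /=; rewrite lern1 leq_b1.
    * move=> x; rewrite -(stpath_flow R (Ep a)) [RHS]big_mkcond.
      by apply: eq_bigr => e _; case: ifP; rewrite ?mulr1 ?mulr0.
    (* A chosen arc raises the integer potential by at least 1; for any other arc, potentials in the
       range 0 to [#|V| - 1] suffice. *)
    * move=> e; have [ub us] := uP a; have := ub (src e); have := us e.
      case: (e \in E a) => [/(_ isT) lt lt'|_ lt'].
        rewrite [_ * true%:R]mulr1; have : (u a (src e) + 1)%:R <= (u a (dst e))%:R :> R.
          by rewrite ler_nat addn1.
        by rewrite natrD; lra.
      have : (u a (src e) + 1)%:R <= #|V|%:R :> R by rewrite ler_nat addn1.
      have := ler0n R (u a (dst e)); rewrite natrD [_ * false%:R]mulr0 => ? ?; lra.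
  + split; last split; last split => //=.
    * by move=> i; rewrite /= oppr_le0.
    * by [].
    * by move=> i e; rewrite oppr_le0 mulr_ge0.
    * move=> i e; have : l i <= 1.
        by rewrite -l1 (bigD1 i) //= lerDl sumr_ge0.
      by have := l0 i; case: (e \in Y i) => /= H1 H2; rewrite ?mulr1 ?mulr0; lra.
  + move=> i; split; last split; last split; last split => /=.
    * by move=> e /=; rewrite oppr_le0.
    * by move=> e /=; rewrite oppr_le0.
    * by move=> e /=; rewrite !inE; case: (e \in X) (e \in Y i) => [] [] /=; lra.
    * by move=> e; rewrite !inE; case: (e \in X) (e \in Y i) => [] [] /=; lra.
    * by have [_ /nbhd_weightsP] := Ynb i.
  + split; [|split] => /=.
    * by rewrite oppr_le0.
    * by move=> e; rewrite oppr_le0.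
    * by move=> e; have := wab e; lra.
- by apply/setP => e; rewrite inE /=; case: (e \in X); rewrite ?eqxx // eq_sym oner_eq0.
rewrite /mip_cost /obj /rrsp_obj -!addrA lerD //; first by rewrite costE.
apply: le_trans val; rewrite -addrA lerD2r.
by apply: ler_sum => e _; rewrite mulr_sumr.
Qed.

End Instance.
End Formulation.

Theorem mainTheorem15 (R : realType) :
  exists c d : nat,
  forall (V Arc : finType) (src dst : Arc -> V) (s t : V) (k : nat) (nb : nbhd),
  (exists X, is_stpath src dst s t X) ->
  exists (M : MIP R Arc) (idx : Arc -> 'I_(nvars M)),
    [/\ (nvars M <= c * (#|V| + #|Arc|).+1 ^ d)%N,
        (nconstr M <= c * (#|V| + #|Arc|).+1 ^ d)%N,
        injective idx,
        (forall e, intv M (idx e)) &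
        forall (C ch D : Arc -> R) (G : R),
          (forall e, 0 <= C e) -> (forall e, 0 <= ch e) -> (forall e, 0 <= D e) ->
          0 <= G ->
          (exists z, mip_optsol M C ch D G z) /\
          (forall z, mip_optsol M C ch D G z ->
             rrsp_optimal src dst s t nb k C ch D G (decode M idx z) /\
             mip_objval M C ch D G z
               = rrsp_obj src dst s t nb k C ch D G (decode M idx z))].
Proof.
(* The [#|Arc|.+2] recovery paths, each with variables per arc and vertex, make the size quadratic;
   100 is a crude common constant. *)
exists 100%N, 2%N => V Arc src dst s t k nb [X0 X0p].
have [n nle Ppoly] := mip_constr_polyhedral R src dst s t k nb.
have [M [iota [kappa [[nv nc] iotaK kappaK intvE MP]]]] :=
  mip_of_polyhedral (@is_arc_var V Arc) Ppoly (mip_cost_objective R V Arc).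
exists M, (fun e => iota (arc_var V None e)); split.
- by rewrite nv card_mip_var.
- by rewrite nc.
- by move=> e f /(can_inj iotaK)[].
- by move=> e; rewrite intvE.
move=> C ch D G C0 ch0 D0 G0.
set dec := decode M _; set obj := rrsp_obj src dst s t nb k C ch D G.
have sound z : mip_feasible M C ch D G z ->
    is_stpath src dst s t (dec z) /\ obj (dec z) <= mip_objval M C ch D G z.
  have [feasE ->] := MP C ch D G z; move/feasE => [zint zP].
  exact: (mip_cost_sound C ch0 D0 G0 zint zP).
have complete X : is_stpath src dst s t X -> exists z, [/\ mip_feasible M C ch D G z,
    dec z = X & mip_objval M C ch D G z <= obj X].
  move=> Xp; have [z [zint zP zX zle]] := mip_cost_complete k nb C ch D G Xp.
  have [feasE objE] := MP C ch D G (z \o kappa).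
  have zE : (fun j => (z \o kappa) (iota j)) = z by apply/funext => j /=; rewrite iotaK.
  rewrite zE in feasE objE.
  exists (z \o kappa); split; last by rewrite objE.
    by apply/feasE; split => // j Ij /=; rewrite iotaK; exact: zint.
  by rewrite -zX; apply/setP => e; rewrite !inE /= iotaK.
split.
  (* The optimum is attained because there are finitely many paths: a best one lifts to a feasible
     point that no other can beat, by soundness. *)
  pose stp : pred {set Arc} := fun X => `[< is_stpath src dst s t X >].
  have X0p' : stp X0 by apply/asboolP.
  have [X /asboolP Xp Xmin] := Order.TotalTheory.arg_minP obj X0p'.
  have [z [zf _ zle]] := complete X Xp.
  exists z; split => // z' /sound[z'p z'le].
  by apply: le_trans zle (le_trans _ z'le); apply: Xmin; apply/asboolP.
move=> z [zf zopt]; have [zp zle] := sound z zf.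
(* Completeness puts the optimal value below every path's objective. With soundness this gives
   optimality of the decoded path and, at that path, equality. *)
have le_all X : is_stpath src dst s t X -> mip_objval M C ch D G z <= obj X.
  by move=> /complete[z' [/zopt + _]]; exact: le_trans.
split; first by split => // Y Yp; apply: le_trans zle (le_all _ Yp).
by apply/le_anti; rewrite zle le_all.
Qed.
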